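(* Let $\ell$ be an odd prime, let $a\in\mathbb{Z}_\ell^\times$, and let $\gamma\in\{\alpha,\alpha'\}$, where $\alpha=\alpha(a,u)$ and $\alpha'=\alpha'(a,u)$ are the two families of voltage assignments on the complete graphs $K_u$ defined in the context. For integers $\mu\geq 0$ and $\lambda$ and real $x>0$, let $\mathcal{T}_{\le x}(\mu,\lambda,\gamma,\ell)$ be the set of integers $u$ with $3\le u\le x$ such that $\mu_{u,\gamma}=\mu$ and $\lambda_{u,\gamma}=\lambda$, and let $\mathcal{A}_{\le x}$ be the set of non-negative integers $u\le x$. Then $$\lim_{x\to\infty}\frac{\#\mathcal{T}_{\le x}(\mu,\lambda,\gamma,\ell)}{\#\mathcal{A}_{\le x}}=\begin{cases}\frac{\ell-2}{\ell}&\text{if }\mu=0\text{ and }\lambda=1,\\ \frac{\ell-1}{\ell^{\mu+1}}&\text{if }\mu>0\text{ and }\lambda=1,\\ 0&\text{if }\lambda\ne1.\end{cases}$$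
   Context: For $b\in\mathbb{Z}_\ell$ put $\binom{b}{n}=\frac{b(b-1)\cdots(b-n+1)}{n!}\in\mathbb{Z}_\ell$ and $(1+T)^b=\sum_{n\ge0}\binom{b}{n}T^n\in\mathbb{Z}_\ell[[T]]$. Let $K_u$ be the complete graph with vertices $v_1,\dots,v_u$ (one undirected edge between each pair of distinct vertices, no loops), with each edge oriented from $v_i$ to $v_j$ for $i<j$. A $\mathbb{Z}_\ell$-valued voltage assignment on $K_u$ is a family $(a_{i,j})_{1\le i<j\le u}$ of elements of $\mathbb{Z}_\ell$. Its characteristic series is $f(T)=\det(m_{i,j}(T))_{1\le i,j\le u}\in\mathbb{Z}_\ell[[T]]$, where $m_{i,i}=u-1$, $m_{i,j}=-(1+T)^{a_{i,j}}$ if $i<j$, and $m_{i,j}=-(1+T)^{-a_{j,i}}$ if $j<i$. Its constant term is $0$. When $f\ne0$ (which holds for the assignments below when $u\ge3$), by Weierstrass preparation write $f(T)=\ell^{\mu}g(T)U(T)$ with $\mu\in\mathbb{Z}_{\geq 0}$, $g$ a distinguished polynomial (monic, all non-leading coefficients divisible by $\ell$) and $U\in\mathbb{Z}_\ell[[T]]^\times$; the invariants of the assignment are $\mu$ and $\lambda:=\deg g-1$ (note the shift by $-1$). For $a\in\mathbb{Z}_\ell^\times$ and $u\ge3$: $\alpha(a,u)$ is the single voltage assignment with $a_{1,2}=a$ and all other $a_{i,j}=0$; $\alpha'(a,u)$ is the assignment with $a_{1,j}=a$ for all $2\le j\le u-1$ and all other $a_{i,j}=0$. Write $\mu_{u,\gamma},\lambda_{u,\gamma}$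 for the invariants of $K_u$ with the assignment $\gamma(a,u)$, $\gamma\in\{\alpha,\alpha'\}$. *)

(* Defs.v *)
From HB Require Import structures.
From mathcomp Require Export all_boot all_order all_algebra finmap.
From mathcomp Require Export all_classical all_reals all_analysis.
Export numFieldNormedType.Exports.

Set Implicit Arguments.
Unset Strict Implicit.
Unset Printing Implicit Defensive.

Import Order.TTheory GRing.Theory Num.Theory.
Local Open Scope ring_scope.
Local Open Scope classical_set_scope.

(* Invertibility in a commutative ring, packaged for ComNzRing_hasMulInverse:
   as in MathComp, the inverse of a non-unit is itself. *)
Section ClassicalUnits.
Variable R : comNzRingType.

Definition cl_unit : {pred R} := fun x => `[< exists y, y * x = 1 >].
Definition cl_inv (x : R) : R := xget x [set y | y * x = 1].

Lemma cl_mulVx : {in cl_unit, left_inverse 1 cl_inv *%R}.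
Proof. by move=> x /asboolP ex; have /= := xgetPex x ex. Qed.

Lemma cl_unitPl (x y : R) : y * x = 1 -> cl_unit x.
Proof. by move=> yx; apply/asboolP; exists y. Qed.

Lemma cl_invr_out : {in [predC cl_unit], cl_inv =1 id}.
Proof.
move=> x /negP xNu; rewrite /cl_inv xgetPN // => y yx.
by apply: xNu; apply: cl_unitPl yx.
Qed.

End ClassicalUnits.

(* The ring Z_l, as the inverse limit of the rings Z/l^(n+1), n >= 0.  The
   exponents start at 1 because 'Z_1 is Z/2; nothing is lost, since the term
   Z/l^0 is trivial.  Meaningful for l >= 2. *)
Record padic (l : nat) := Padic {
  padic_res :> forall n, 'Z_(l ^ n.+1);
  padic_coh : forall n, (padic_res n.+1 : nat)%:R = padic_res n }.

Section PadicRing.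
Variable l : nat.

Lemma padicP (x y : padic l) : (forall n, x n = y n) -> x = y.
Proof.
case: x y => [x cx] [y cy] /= exy.
have e : x = y by apply: functional_extensionality_dep.
by case: _ / e cy => cy; congr Padic; apply: Prop_irrelevance.
Qed.

HB.instance Definition _ := gen_eqMixin (padic l).
HB.instance Definition _ := gen_choiceMixin (padic l).

Lemma Zp_trunc_dvd n :
  ((Zp_trunc (l ^ n.+1)).+2 %| (Zp_trunc (l ^ n.+2)).+2)%N.
Proof.
case: l => [|[|m]]; first by rewrite !exp0n.
  by rewrite !exp1n.
have gt1 k : (1 < m.+2 ^ k.+1)%N.
  by apply: (@leq_trans (m.+2 ^ 1)) => //; rewrite leq_exp2l.
by rewrite !Zp_cast // dvdn_exp2l.
Qed.

Lemma Zp_red_mod n k :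
  (k %% (Zp_trunc (l ^ n.+2)).+2)%:R = k%:R :> 'Z_(l ^ n.+1).
Proof. by apply: val_inj; rewrite !Zp_nat /= modn_dvdm ?Zp_trunc_dvd. Qed.

Lemma padic0_coh n : ((0%R : 'Z_(l ^ n.+2)) : nat)%:R = 0 :> 'Z_(l ^ n.+1).
Proof. by []. Qed.
Definition padic0 := Padic (padic_res := fun=> 0) padic0_coh.

Lemma padic1_coh n : ((1%R : 'Z_(l ^ n.+2)) : nat)%:R = 1 :> 'Z_(l ^ n.+1).
Proof. by rewrite /= modn_small. Qed.
Definition padic1 := Padic (padic_res := fun=> 1) padic1_coh.

Lemma padicD_coh (x y : padic l) n :
  (((x n.+1 + y n.+1)%R : 'Z_(l ^ n.+2)) : nat)%:R = x n + y n.
Proof. by rewrite /= Zp_red_mod natrD !padic_coh. Qed.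
Definition padicD (x y : padic l) :=
  Padic (padic_res := fun n => x n + y n) (padicD_coh x y).

Lemma padicM_coh (x y : padic l) n :
  (((x n.+1 * y n.+1)%R : 'Z_(l ^ n.+2)) : nat)%:R = x n * y n.
Proof. by rewrite /= Zp_red_mod natrM !padic_coh. Qed.
Definition padicM (x y : padic l) :=
  Padic (padic_res := fun n => x n * y n) (padicM_coh x y).

Lemma padicN_coh (x : padic l) n :
  (((- x n.+1)%R : 'Z_(l ^ n.+2)) : nat)%:R = - x n.
Proof.
apply/eqP; rewrite -addr_eq0 -(padic_coh x n) -natrD -Zp_red_mod.
by rewrite modnDml subnK ?modnn // ltnW // ltn_ord.
Qed.
Definition padicN (x : padic l) := Padic (padic_res := fun n => - x n) (padicN_coh x).

Fact padicDA : associative padicD.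
Proof. by move=> x y z; apply: padicP => n; apply: addrA. Qed.
Fact padicDC : commutative padicD.
Proof. by move=> x y; apply: padicP => n; apply: addrC. Qed.
Fact padic0D : left_id padic0 padicD.
Proof. by move=> x; apply: padicP => n; apply: add0r. Qed.
Fact padicND : left_inverse padic0 padicN padicD.
Proof. by move=> x; apply: padicP => n; apply: addNr. Qed.

HB.instance Definition _ :=
  GRing.isZmodule.Build (padic l) padicDA padicDC padic0D padicND.

Fact padicMA : associative padicM.
Proof. by move=> x y z; apply: padicP => n; apply: mulrA. Qed.
Fact padicMC : commutative padicM.
Proof. by move=> x y; apply: padicP => n; apply: mulrC. Qed.
Fact padic1M : left_id padic1 padicM.
Proof. by move=> x; apply: padicP => n; apply: mul1r. Qed.
Fact padicMDl : left_distributive padicM +%R.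
Proof. by move=> x y z; apply: padicP => n; apply: mulrDl. Qed.
Fact padic1_neq0 : padic1 != 0.
Proof.
apply/eqP => /(congr1 (fun x : padic l => x 0%N)) /= /eqP.
by rewrite oner_eq0.
Qed.

HB.instance Definition _ := GRing.Zmodule_isComNzRing.Build (padic l)
  padicMA padicMC padic1M padicMDl padic1_neq0.

HB.instance Definition _ := GRing.ComNzRing_hasMulInverse.Build (padic l)
  (@cl_mulVx (padic l)) (@cl_unitPl (padic l)) (@cl_invr_out (padic l)).

End PadicRing.

(* The ring R[[T]]: f n is the coefficient of T^n in f. *)
Record fps (R : Type) := Fps { fps_coef :> nat -> R }.

Section FpsRing.
Variable R : comNzRingType.
Implicit Types f g h : fps R.

Lemma fpsP f g : f =1 g -> f = g.
Proof. by case: f g => [f] [g] /= /funext ->. Qed.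

HB.instance Definition _ := gen_eqMixin (fps R).
HB.instance Definition _ := gen_choiceMixin (fps R).

Definition fpsC (c : R) : fps R := Fps (fun n => if n == 0%N then c else 0).
Definition fpsD f g := Fps (fun n => f n + g n).
Definition fpsN f := Fps (fun n => - f n).
Definition fpsM f g := Fps (fun n => \sum_(i < n.+1) f i * g (n - i)%N).
Definition fps_of_poly (p : {poly R}) : fps R := Fps (fun n => p`_n).

Fact fpsDA : associative fpsD.
Proof. by move=> f g h; apply: fpsP => n; apply: addrA. Qed.
Fact fpsDC : commutative fpsD.
Proof. by move=> f g; apply: fpsP => n; apply: addrC. Qed.
Fact fps0D : left_id (fpsC 0) fpsD.
Proof. by move=> f; apply: fpsP => n /=; rewrite if_same add0r. Qed.
Fact fpsND : left_inverse (fpsC 0) fpsN fpsD.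
Proof. by move=> f; apply: fpsP => n /=; rewrite if_same addNr. Qed.

HB.instance Definition _ :=
  GRing.isZmodule.Build (fps R) fpsDA fpsDC fps0D fpsND.

Definition fps_trunc n f : {poly R} := \poly_(i < n.+1) f i.

Lemma coef_fps_trunc n f i : (i <= n)%N -> (fps_trunc n f)`_i = f i.
Proof. by move=> le_in; rewrite coef_poly ltnS le_in. Qed.

Lemma coef_truncM n f g (p q : {poly R}) :
    (forall i, (i <= n)%N -> p`_i = f i) ->
    (forall i, (i <= n)%N -> q`_i = g i) ->
  forall i, (i <= n)%N -> (p * q)`_i = fpsM f g i.
Proof.
move=> pf qg i le_in; rewrite coefM; apply: eq_bigr => j _.
have le_ji : (j <= i)%N by rewrite -ltnS.
by rewrite pf ?qg // (leq_trans _ le_in) // leq_subr.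
Qed.

Fact fpsMA : associative fpsM.
Proof.
move=> f g h; apply: fpsP => n.
have t := coef_fps_trunc (n := n).
rewrite -(coef_truncM (t f) (coef_truncM (t g) (t h)) (leqnn n)).
by rewrite -(coef_truncM (coef_truncM (t f) (t g)) (t h) (leqnn n)) mulrA.
Qed.
Fact fpsMC : commutative fpsM.
Proof.
move=> f g; apply: fpsP => n; have t := coef_fps_trunc (n := n).
rewrite -(coef_truncM (t f) (t g) (leqnn n)).
by rewrite -(coef_truncM (t g) (t f) (leqnn n)) mulrC.
Qed.
Fact fps1M : left_id (fpsC 1) fpsM.
Proof.
move=> f; apply: fpsP => n /=; rewrite big_ord_recl /= mul1r subn0.
by rewrite big1 ?addr0 // => i _; rewrite mul0r.
Qed.
Fact fpsMDl : left_distributive fpsM +%R.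
Proof.
move=> f g h; apply: fpsP => n /=; rewrite -big_split /=.
by apply: eq_bigr => i _; rewrite mulrDl.
Qed.
Fact fps1_neq0 : fpsC 1 != 0.
Proof.
apply/eqP => /(congr1 (fun f : fps R => f 0%N)) /= /eqP.
by rewrite oner_eq0.
Qed.

HB.instance Definition _ := GRing.Zmodule_isComNzRing.Build (fps R)
  fpsMA fpsMC fps1M fpsMDl fps1_neq0.

HB.instance Definition _ := GRing.ComNzRing_hasMulInverse.Build (fps R)
  (@cl_mulVx (fps R)) (@cl_unitPl (fps R)) (@cl_invr_out (fps R)).

End FpsRing.

Section Invariants.
Variable l : nat.

(* b (b - 1) ... (b - n + 1) / n!; for l prime the quotient exists in Z_l, and
   it is unique because Z_l is torsion-free. *)
Definition padic_binom (b : padic l) (n : nat) : padic l :=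
  xget 0 [set c | c * n`!%:R = \prod_(i < n) (b - i%:R)].

(* (1 + T)^b *)
Definition onePT_pow (b : padic l) : fps (padic l) := Fps (padic_binom b).

Definition distinguished (g : {poly padic l}) : Prop :=
  g \is monic /\
  forall i, (i < (size g).-1)%N -> exists c, g`_i = l%:R * c.

Definition weierstrass (f : fps (padic l)) (mu : nat) (g : {poly padic l}) :
    Prop :=
  distinguished g /\
  exists U : fps (padic l),
    U \is a GRing.unit /\ f = l%:R ^+ mu * fps_of_poly g * U.

(* For l prime and f != 0, the pair (mu, g) exists and is unique by Weierstrass
   preparation; the default value (0, 0) is only used when f = 0. *)
Definition weierstrass_pair (f : fps (padic l)) : nat * {poly padic l} :=
  xget (0%N, 0) [set mg | weierstrass f mg.1 mg.2].

Definition mu_inv (f : fps (padic l)) : nat := (weierstrass_pair f).1.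

(* deg g - 1, where deg g = (size g).-1 *)
Definition lambda_inv (f : fps (padic l)) : int :=
  (size (weierstrass_pair f).2).-1%:Z - 1.

(* The vertex v_(i+1) of K_u is i : 'I_u.  Only the values at i < j matter. *)
Definition voltage (u : nat) := 'I_u -> 'I_u -> padic l.

Definition char_matrix u (v : voltage u) : 'M[fps (padic l)]_u :=
  \matrix_(i < u, j < u)
    if i == j then u%:R - 1
    else if (i < j)%N then - onePT_pow (v i j)
    else - onePT_pow (- v j i).

Definition char_series u (v : voltage u) : fps (padic l) :=
  \det (char_matrix v).

Definition alpha (a : padic l) (u : nat) : voltage u :=
  fun i j => if (i == 0%N :> nat) && (j == 1%N :> nat) then a else 0.

(* In 1-based indices: i = 1 and 2 <= j <= u - 1. *)
Definition alpha' (a : padic l) (u : nat) : voltage u :=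
  fun i j => if (i == 0%N :> nat) && (1 <= j < u.-1)%N then a else 0.

End Invariants.

Definition T_set (R : realType) (l : nat) (mu : nat) (lambda : int)
    (gamma : forall u, voltage l u) (x : R) : set nat :=
  [set u | [/\ (3 <= u)%N, u%:R <= x,
               mu_inv (char_series (gamma u)) = mu
             & lambda_inv (char_series (gamma u)) = lambda]].

Definition A_set (R : realType) (x : R) : set nat := [set u | u%:R <= x].

(* Main.v *)
(* For both assignments only the voltages X = (1 + T)^a and its inverse occur,
   and (up to a change of the vertex potentials and a renumbering) on a single
   edge.  Eliminating the vertices away from this edge gives
     f = u^(u-3) (u - 2) (2 - X - 1/X) = - u^(u-3) (u - 2) (X - 1)^2 / X,
   and X - 1 is T times a unit as a is a unit.  Hence lambda = 1 and
   mu = (u - 3) v(u) + v(u - 2) for the l-adic valuation v.  Apart from finitely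
   many u, mu is positive when l divides u and exceeds any fixed bound, so the
   density is the one of the u with v(u - 2) = mu, from which for mu = 0 the
   multiples of l must be removed. *)

Require Import Defs.
From mathcomp Require Import ring lra zify fingroup perm.

Set Implicit Arguments.
Unset Strict Implicit.
Unset Printing Implicit Defensive.

Import Order.TTheory GRing.Theory Num.Theory.
Local Open Scope ring_scope.
Local Open Scope classical_set_scope.

(** * Arithmetic of $\mathbb{Z}_\ell$: torsion-freeness and units *)

Section PadicArithmetic.
Variables (l : nat) (l_prime : prime l).
Implicit Types (x y b : padic l) (n v N k : nat).

Lemma expn_prime_gt1 n : (1 < l ^ n.+1)%N.
Proof. by rewrite -{1}(exp1n n.+1) ltn_exp2r // prime_gt1. Qed.

Lemma natr_Zexp_eq0 n k : (k%:R == 0 :> 'Z_(l ^ n.+1)) = (l ^ n.+1 %| k)%N.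
Proof. by rewrite -val_eqE /= val_Zp_nat ?expn_prime_gt1. Qed.

Lemma natr_Zexp_eq n k k' :
  (k%:R == k'%:R :> 'Z_(l ^ n.+1)) = (k == k' %[mod l ^ n.+1])%N.
Proof. by rewrite -val_eqE /= !val_Zp_nat ?expn_prime_gt1. Qed.

Lemma natr_padic k n : (k%:R : padic l) n = k%:R.
Proof. by elim: k => // k IHk; rewrite !mulrS -IHk. Qed.

Lemma padic_natr x n : (x n : nat)%:R = x n.
Proof. exact: natr_Zp. Qed.

Lemma padic_cohD x n v : (x (n + v)%N : nat)%:R = x n.
Proof.
elim: v => [|v IHv]; first by rewrite addn0 padic_natr.
rewrite -IHv -(padic_coh x (n + v)); apply/eqP.
rewrite natr_Zexp_eq addnS val_Zp_nat ?expn_prime_gt1 //.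
by rewrite modn_dvdm // dvdn_exp2l // ltnS leq_addr.
Qed.

(** Dividing by [N] costs exactly [logn l N] digits of precision. *)
Lemma dvdn_expl_mul N k n : (0 < N)%N ->
  (l ^ (n + logn l N) %| N * k)%N -> (l ^ n %| k)%N.
Proof.
case: k => // k N0; rewrite !pfactor_dvdn ?muln_gt0 ?N0 //.
by rewrite lognM // addnC leq_add2l.
Qed.

(** Torsion-freeness: if $Nz=0$, reading this at level [n + logn l N] and dividing by [N] there
    shows that the residue of $z$ at level [n] vanishes. *)
Lemma padic_natr_lreg N : (0 < N)%N -> GRing.lreg (N%:R : padic l).
Proof.
move=> N0; have Ninj z : (N%:R : padic l) * z = 0 -> z = 0.
  move=> Nz; apply: padicP => n; apply/eqP.
  rewrite -(padic_cohD z n (logn l N)) natr_Zexp_eq0.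
  apply: (dvdn_expl_mul N0); rewrite -natr_Zexp_eq0 natrM padic_natr.
  by have /(congr1 (fun x : padic l => x (n + logn l N)%N))/= := Nz;
     rewrite natr_padic => ->.
move=> x y /= /eqP; rewrite -subr_eq0 -mulrBr => /eqP/Ninj/eqP.
by rewrite subr_eq0 => /eqP.
Qed.

Lemma padic_unit_neq0 x : x \is a GRing.unit -> x 0%N != 0.
Proof.
move=> /unitrPr[y] /(congr1 (fun z : padic l => z 0%N))/= xy.
by apply/eqP => x0; move/eqP: xy; rewrite x0 mul0r eq_sym oner_eq0.
Qed.

Lemma padic_prime_mul0 x : (l%:R * x) 0%N = 0.
Proof.
rewrite /= natr_padic; apply/eqP.
by have /eqP-> : l%:R == 0 :> 'Z_(l ^ 1);
  rewrite ?natr_Zexp_eq0 ?expn1 ?mul0r.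
Qed.

(** The inverses in the residue rings are coherent because inverses are unique. *)
Lemma padic_natr_unit k : coprime l k -> (k%:R : padic l) \is a GRing.unit.
Proof.
move=> lk; have ku n : (k%:R : 'Z_(l ^ n.+1)) \is a GRing.unit.
  by rewrite unitZpE ?expn_prime_gt1 // coprimeXl.
have coh n : (((k%:R : 'Z_(l ^ n.+2))^-1 : 'Z_(l ^ n.+2)) : nat)%:R
     = (k%:R)^-1 :> 'Z_(l ^ n.+1).
  apply: (mulrI (ku n)); rewrite divrr ?ku // -natrM; apply/eqP.
  rewrite -[1]/(1%:R) natr_Zexp_eq; apply/eqP.
  have /dvdn_exp2l d : (n.+1 <= n.+2)%N by [].
  rewrite -(modn_dvdm _ (d l)) -[RHS](modn_dvdm _ (d l)); congr (_ %% _)%N.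
  by apply/eqP; rewrite -natr_Zexp_eq natrM natr_Zp (mulrV (ku n.+1)).
apply/unitrPr; exists (Padic coh); apply: padicP => n /=.
by rewrite natr_padic divrr ?ku.
Qed.

End PadicArithmetic.

(** * Falling factorials and Vandermonde's identity *)

Section FallingFactorial.
Variable R : comPzRingType.
Implicit Types (x y : R) (n : nat).

(** The product in [padic_binom], over a general ring so that it can also be evaluated in the
    residue rings. *)
Definition falling x n : R := \prod_(i < n) (x - i%:R).

Lemma falling0 x : falling x 0 = 1. Proof. exact: big_ord0. Qed.

Lemma fallingS x n : falling x n.+1 = falling x n * (x - n%:R).
Proof. exact: big_ord_recr. Qed.

Lemma falling_ffact k n : falling k%:R n = (k ^_ n)%:R.
Proof.
elim: n => [|n IHn]; first by rewrite falling0.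
rewrite fallingS IHn ffactnSr natrM; case: (leqP n k) => [le_nk|lt_kn].
  by rewrite natrB.
by rewrite ffact_small // !mul0r.
Qed.

Lemma falling_Vandermonde x y n :
  \sum_(i < n.+1) (falling x i * falling y (n - i)) *+ 'C(n, i) =
  falling (x + y) n.
Proof.
elim: n => [|n IHn].
  by rewrite big_ord_recl big_ord0 /= !falling0 mul1r addr0.
apply/esym; rewrite fallingS -IHn mulr_suml.
pose F i j := falling x i * falling y j.
(* The new factor splits as $x+y-n=(x-i)+(y-(n-i))$, each part extending one of the two products;
   Pascal's rule then recombines the sums. *)
have step (i : 'I_n.+1) :
    F i (n - i)%N *+ 'C(n, i) * (x + y - n%:R) =
    F i.+1 (n - i)%N *+ 'C(n, i) + F i (n.+1 - i)%N *+ 'C(n, i).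
  have le_in : (i <= n)%N by rewrite -ltnS.
  rewrite /F subSn // !fallingS -mulrnDl mulrnAl; congr (_ *+ _).
  by rewrite natrB //; ring.
rewrite (eq_bigr _ (fun i _ => step i)) big_split /=.
have -> : \sum_(i < n.+1) F i (n.+1 - i)%N *+ 'C(n, i) =
    F 0%N n.+1 + \sum_(i < n.+1) F i.+1 (n - i)%N *+ 'C(n, i.+1).
  transitivity (\sum_(i < n.+2) F i (n.+1 - i)%N *+ 'C(n, i)).
    by rewrite [RHS]big_ord_recr /= bin_small // addr0.
  by rewrite big_ord_recl bin0 subn0.
rewrite [RHS]big_ord_recl bin0 subn0 addrCA -big_split; congr (_ + _).
by apply: eq_bigr => i _; rewrite /= /bump /= add1n binS mulrnDr subSS addrC.
Qed.

End FallingFactorial.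

(** * Binomial coefficients over $\mathbb{Z}_\ell$ and the series $(1+T)^b$ *)

Section PadicBinomial.
Variables (l : nat) (l_prime : prime l).
Implicit Types (b : padic l) (n : nat).

Lemma falling_padic b n k : falling b n k = falling (b k) n.
Proof.
elim: n => [|n IHn]; first by rewrite !falling0.
by rewrite !fallingS -IHn /= natr_padic.
Qed.

Lemma eqn_bin_mod n k m m' :
  m = m' %[mod l ^ (k.+1 + logn l n`!)] -> 'C(m, n) = 'C(m', n) %[mod l ^ k.+1].
Proof.
(* The ordering makes the truncated difference of the two binomials a true one. *)
wlog le_mm' : m m' / ('C(m', n) <= 'C(m, n))%N.
  move=> W mm'; case: (leqP 'C(m', n) 'C(m, n)) => [|/ltnW] le; first exact: W.
  by apply/esym/W => //; apply/esym.
rewrite addSn => /eqP; rewrite -natr_Zexp_eq // => /eqP mm'.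
apply/eqP; rewrite eqn_mod_dvd //; apply: (@dvdn_expl_mul _ l_prime n`!).
  exact: fact_gt0.
rewrite mulnC mulnBl !bin_ffact addSn -eqn_mod_dvd; last first.
  by rewrite -!bin_ffact leq_mul2r le_mm' orbT.
by rewrite -natr_Zexp_eq // -!falling_ffact mm'.
Qed.

Lemma padic_binom_ex b n : exists c : padic l, c * n`!%:R = falling b n.
Proof.
(* An ordinary binomial of an integer approximation to [b], with the extra digits needed for its
   residue at level [k] to be well defined. *)
pose c k : 'Z_(l ^ k.+1) := 'C(b (k + logn l n`!)%N, n)%:R.
have coh k : (c k.+1 : nat)%:R = c k.
  apply/eqP; rewrite natr_Zexp_eq // val_Zp_nat ?expn_prime_gt1 //.
  rewrite modn_dvdm ?dvdn_exp2l //; apply/eqP/eqn_bin_mod; apply/eqP.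
  by rewrite addSn -natr_Zexp_eq // padic_coh padic_natr.
exists (Padic coh); apply: padicP => k /=.
rewrite natr_padic /c -natrM bin_ffact -falling_ffact padic_cohD //.
by rewrite falling_padic.
Qed.

Lemma padic_binomE b n : padic_binom b n * n`!%:R = falling b n.
Proof. exact: (xgetPex 0 (padic_binom_ex b n)). Qed.

(** By torsion-freeness, identities between coefficients may be checked after multiplication by
    $n!$. *)
Lemma padic_binom_uniq b n c : c * n`!%:R = falling b n -> padic_binom b n = c.
Proof.
rewrite -padic_binomE => cn; apply: (padic_natr_lreg l_prime (fact_gt0 n)).
by rewrite mulrC -cn mulrC.
Qed.

Lemma padic_binom0 b : padic_binom b 0 = 1.
Proof. by apply: padic_binom_uniq; rewrite falling0 mulr1. Qed.

Lemma padic_binom1 b : padic_binom b 1 = b.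
Proof. by apply: padic_binom_uniq; rewrite fallingS falling0 mul1r mulr1 subr0. Qed.

Lemma falling_0l n : falling 0 n.+1 = 0 :> padic l.
Proof. by rewrite /falling big_ord_recl subr0 mul0r. Qed.

Lemma onePT_pow0 : onePT_pow (0 : padic l) = 1.
Proof.
apply: fpsP => -[|n] /=; first exact: padic_binom0.
by apply: padic_binom_uniq; rewrite mul0r falling_0l.
Qed.

(** Multiplied by $n!$, the identity of $n$-th coefficients is Vandermonde's. *)
Lemma onePT_powD b b' : onePT_pow b * onePT_pow b' = onePT_pow (b + b').
Proof.
apply: fpsP => n; apply/esym/padic_binom_uniq; rewrite -falling_Vandermonde.
rewrite mulr_suml; apply: eq_bigr => i _; rewrite -!padic_binomE /=.
have le_in : (i <= n)%N by rewrite -ltnS.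
rewrite -(bin_fact le_in) -mulr_natr !natrM; ring.
Qed.

End PadicBinomial.

(** * Units and multiplication in the ring of formal power series *)

Section PowerSeries.
Variable R : comUnitRingType.
Implicit Types f g h : fps R.

Lemma fps_sum (I : Type) (r : seq I) (F : I -> fps R) n :
  (\sum_(i <- r) F i) n = \sum_(i <- r) F i n.
Proof. by apply: (big_morph (fun f : fps R => f n)) => //=; rewrite if_same. Qed.

Lemma fps_natM k f n : (k%:R * f) n = k%:R * f n.
Proof.
rewrite !mulr_natl; elim: k => [|k IHk]; first by rewrite !mulr0n /= if_same.
by rewrite !mulrS -IHk.
Qed.

Lemma fps_exp_low h n i : h 0%N = 0 -> (i < n)%N -> (h ^+ n) i = 0.
Proof.
move=> h0; elim: n i => // n IHn i; rewrite ltnS exprS => le_in /=.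
rewrite big_ord_recl h0 mul0r add0r big1 // => j _.
rewrite IHn ?mulr0 // /lift /= /bump /=.
by have := ltn_ord j; lia.
Qed.

(** The inverse is the geometric series. Since $T^k$ divides $h^k$, its coefficient of $T^n$ is a
    finite sum over $k\le n$. *)
Lemma fps_geom_unit h : h 0%N = 0 -> 1 - h \is a GRing.unit.
Proof.
move=> h0; apply/unitrPr.
exists (Fps (fun n => \sum_(k < n.+1) (h ^+ k) n)); apply: fpsP => n.
(* Up to degree [n] the inverse agrees with one fixed partial sum, for which the product telescopes
   to $1-h^{n+1}$. *)
transitivity (((1 - h) * \sum_(k < n.+1) h ^+ k) n).
  apply: eq_bigr => i _; congr (_ * _); rewrite /= fps_sum.
  have le_in : ((n - i).+1 <= n.+1)%N by rewrite ltnS leq_subr.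
  rewrite (big_ord_widen _ (fun k => (h ^+ k) (n - i)%N) le_in) big_mkcond.
  apply: eq_bigr => k _; case: ifP => // /negbT; rewrite -ltnNge => lt_ik.
  by rewrite fps_exp_low.
rewrite -opprB mulNr -subrX1 opprB.
by rewrite [LHS]/= fps_exp_low // oppr0 addr0.
Qed.

Lemma fps_unitP f : (f \is a GRing.unit) = (f 0%N \is a GRing.unit).
Proof.
have coef0M g h : (g * h) 0%N = g 0%N * h 0%N.
  by rewrite /= big_ord_recl big_ord0 addr0.
apply/idP/idP => [/unitrPr[g fg]|f0u].
  by apply/unitrPr; exists (g 0%N); rewrite -coef0M fg.
(* Normalizing the constant term to 1 reduces to the geometric series. *)
pose c : fps R := fpsC (f 0%N)^-1; pose h : fps R := 1 - c * f.
have : 1 - h \is a GRing.unit.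
  apply: fps_geom_unit; have -> : h 0%N = 1 - (c * f) 0%N by [].
  by rewrite coef0M mulVr ?subrr.
by rewrite /h subKr unitrM => /andP[].
Qed.

Lemma fps_of_polyM (p q : {poly R}) :
  fps_of_poly (p * q) = fps_of_poly p * fps_of_poly q.
Proof. by apply: fpsP => n /=; rewrite coefM. Qed.

Lemma fps_mulX f n :
  (fps_of_poly 'X * f) n = if n is n'.+1 then f n' else 0.
Proof.
rewrite /= big_ord_recl coefX mul0r add0r; case: n => [|n].
  by rewrite big_ord0.
rewrite big_ord_recl coefX mul1r big1 ?addr0 ?subSS ?subn0 // => i _.
by rewrite coefX mul0r.
Qed.

End PowerSeries.

(** * Uniqueness and computation of the Weierstrass invariants *)

Section WeierstrassInvariants.
Variables (l : nat) (l_prime : prime l).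
Implicit Types (f h : fps (padic l)) (m d n : nat) (g : {poly padic l}).

Lemma padic_sum (I : Type) (r : seq I) (F : I -> padic l) n :
  (\sum_(i <- r) F i) n = \sum_(i <- r) F i n.
Proof. exact: (big_morph (fun x : padic l => x n)). Qed.

(* [m] is the minimal valuation of the coefficients of [f], and [d] the first
   index at which it is attained. *)
Definition leading_index f m d := exists h, [/\ f = (l ^ m)%:R * h,
  forall i, (i < d)%N -> h i 0%N = 0 & h d 0%N != 0].

(** Modulo $\ell$, which is level 0 of [padic], $g$ reduces to $T^{\deg g}$ and $U$ stays a unit, so
    $gU$ starts in degree $\deg g$. *)
Lemma weierstrass_leading_index f m g :
  weierstrass f m g -> leading_index f m (size g).-1.
Proof.
case=> -[g_monic g_low] [U [Uu ->]]; exists (fps_of_poly g * U).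
have g0 i : (i < (size g).-1)%N -> g`_i 0%N = 0.
  by case/g_low => c ->; apply: padic_prime_mul0.
split=> [|i lt_id|]; first by rewrite mulrA natrX.
  rewrite /= padic_sum big1 // => j _; rewrite /= g0 ?mul0r //.
  by apply: leq_ltn_trans lt_id; rewrite -ltnS.
rewrite /= padic_sum big_ord_recr big1 /=; last by move=> j _; rewrite g0 ?mul0r.
move/eqP: g_monic; rewrite /lead_coef => ->.
by rewrite subnn add0r mul1r padic_unit_neq0 // -fps_unitP.
Qed.

(** This makes $\mu$ and $\deg g$ independent of the factorization that [xget] selects. *)
Lemma leading_index_uniq f m d m' d' :
  leading_index f m d -> leading_index f m' d' -> m = m' /\ d = d'.
Proof.
(* If $k<k'$, cancelling $\ell^k$ would make every coefficient of $h$ divisible by $\ell$. *)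
have le_m h h' k k' e : (l ^ k)%:R * h = (l ^ k')%:R * h' ->
    h e 0%N != 0 -> (k' <= k)%N.
  move=> E he; rewrite leqNgt; apply: contra he => lt_kk'.
  have := congr1 (fun f : fps (padic l) => f e) E.
  rewrite !fps_natM -(subnKC lt_kk') addSn -addnS expnD natrM -mulrA.
  have l_gt0 : (0 < l ^ k)%N by rewrite expn_gt0 prime_gt0.
  move/(padic_natr_lreg l_prime l_gt0) => ->.
  by rewrite (expnS l (k' - k.+1)) natrM -mulrA padic_prime_mul0.
have le_d h h' e e' k : (l ^ k)%:R * h = (l ^ k)%:R * h' ->
    (forall i, (i < e)%N -> h i 0%N = 0) -> h' e' 0%N != 0 -> (e <= e')%N.
  move=> E h0 he'; rewrite leqNgt; apply: contra he' => /h0 he'.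
  have l_gt0 : (0 < l ^ k)%N by rewrite expn_gt0 prime_gt0.
  have := congr1 (fun f : fps (padic l) => f e') E.
  by rewrite !fps_natM => /(padic_natr_lreg l_prime l_gt0) <-; rewrite he'.
case=> h [-> h0 hd] [h' [E h'0 h'd']].
have mm' : m = m'.
  by apply/eqP; rewrite eqn_leq (le_m _ _ _ _ _ E hd) (le_m _ _ _ _ _ (esym E) h'd').
split=> //; rewrite -mm' in E; apply/eqP; rewrite eqn_leq.
by rewrite (le_d _ _ _ _ _ E h0 h'd') (le_d _ _ _ _ _ (esym E) h'0 hd).
Qed.

(** The prime-to-$\ell$ part of [N] is a unit and is absorbed into $U$; $T^n$ is distinguished. *)
Lemma weierstrass_XnM N n (V : fps (padic l)) : (0 < N)%N ->
  V \is a GRing.unit ->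
  weierstrass (N%:R * fps_of_poly 'X^n * V) (logn l N) 'X^n.
Proof.
move=> N0 Vu; have [w lw NE] := pfactor_coprime l_prime N0.
split.
  split; first exact: monicXn.
  move=> i; rewrite size_polyXn coefXn => /ltn_eqF ->.
  by exists 0; rewrite mulr0.
exists (w%:R * V); split.
  rewrite unitrM Vu andbT fps_unitP.
  have -> : (w%:R : fps (padic l)) 0%N = w%:R.
    by rewrite -[w%:R in LHS]mulr1 fps_natM mulr1.
  exact: padic_natr_unit.
by rewrite {1}NE natrM natrX; ring.
Qed.

Lemma weierstrass_invariants N n (V : fps (padic l)) : (0 < N)%N ->
    V \is a GRing.unit -> let f := N%:R * fps_of_poly 'X^n * V in
  mu_inv f = logn l N /\ lambda_inv f = n%:Z - 1.
Proof.
move=> N0 Vu f; have fW := weierstrass_XnM n N0 Vu.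
have ex : exists mg : nat * {poly padic l}, weierstrass f mg.1 mg.2.
  by exists (logn l N, 'X^n).
have /= fW' := xgetPex (0%N, 0) ex.
have [mE dE] := leading_index_uniq (weierstrass_leading_index fW')
  (weierstrass_leading_index fW).
by split; [exact: mE | rewrite /lambda_inv /weierstrass_pair dE size_polyXn].
Qed.


End WeierstrassInvariants.

(** * Determinants of the two families of matrices *)

Section OneEdge.
Variable R : comNzRingType.
Implicit Types (X Y : R) (n : nat).

(** [X] and [Y] stand for $(1+T)^a$ and $(1+T)^{-a}$; the relation $XY=1$ is imposed only when the
    determinant is computed. *)
Definition one_edge_mx n X Y : 'M[R]_n :=
  \matrix_(i < n, j < n)
    if i == j then n%:R - 1
    else if (i == 0%N :> nat) && (j == 1%N :> nat) then - X
    else if (i == 1%N :> nat) && (j == 0%N :> nat) then - Y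
    else - 1.

Lemma det_mx33 (A : 'M[R]_3) :
  \det A =
    A 0 0 * (A 1 1 * A 2%:R 2%:R - A 1 2%:R * A 2%:R 1)
  - A 0 1 * (A 1 0 * A 2%:R 2%:R - A 1 2%:R * A 2%:R 0)
  + A 0 2%:R * (A 1 0 * A 2%:R 1 - A 1 1 * A 2%:R 0).
Proof.
(* Indexing by naturals lets the lifted indices of the minors compute. *)
pose a (i j : nat) := A (inord i) (inord j).
have aE i j : A i j = a i j by rewrite /a !inord_val.
rewrite (expand_det_row _ 0) !big_ord_recl big_ord0 /cofactor.
rewrite !(expand_det_row _ 0) !big_ord_recl !big_ord0 /cofactor !det_mx11 !mxE.
by rewrite !aE /= /bump /=; ring.
Qed.

(** Block elimination: all vertices from the third on see the rest of the graph alike, so the last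
    [n] of them can be cleared against the third, leaving a 3 by 3 determinant. *)
Lemma det_one_edge_mx n X Y : X * Y = 1 ->
  \det (one_edge_mx n.+3 X Y) = (n.+3 ^ n * n.+1)%:R * (2 - X - Y).
Proof.
move=> XY1; pose u : R := n.+3%:R.
pose M : 'M[R]_(3 + n) := one_edge_mx n.+3 X Y.
pose A := ulsubmx M.
pose G : 'M[R]_(n, 3) := \matrix_(i, j) - (j == 2 :> nat)%:R.
pose H : 'M[R]_(n, 3) := \matrix_(i, j) (j == 2 :> nat)%:R.
have HE p (B : 'M[R]_(p, n)) i j :
  (B *m H) i j = (\sum_k B i k) * (j == 2 :> nat)%:R.
  by rewrite mxE mulr_suml; apply: eq_bigr => k _; rewrite mxE.
have -> : \det (one_edge_mx n.+3 X Y) =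
    \det (A + ursubmx M *m H) * u ^+ n.
  (* The left factor subtracts the third row from each later row; the right one adds all later
     columns to the third. The result is block upper triangular with lower block $u\cdot 1$. *)
  have <- : \det (block_mx 1%:M 0 G 1%:M *m M *m block_mx 1%:M 0 H 1%:M)
      = \det (one_edge_mx n.+3 X Y).
    by rewrite !det_mulmx !det_lblock !det1 !mul1r mulr1.
  have GE p (B : 'M[R]_(3, p)) i j : (G *m B) i j = - B 2%:R j.
    rewrite mxE !big_ord_recl big_ord0 !mxE /= oppr0 !mul0r !add0r addr0 mulN1r.
    by congr (- B _ _); apply: val_inj.
  have E1 : G *m ursubmx M + drsubmx M = u%:M.
    apply/matrixP => i j; rewrite mxE GE !mxE -!val_eqE /= eqn_add2l opprK.
    by case: eqVneq => _; rewrite ?mulr1n ?mulr0n; ring.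
  have E2 : G *m A + dlsubmx M + u%:M *m H = 0.
    apply/matrixP => i j; rewrite mul_scalar_mx mxE [X in X + _]mxE GE !mxE -!val_eqE /=.
    by case: j => -[|[|[|//]]] ? /=; ring.
  rewrite -[in LHS](submxK M) -/A !mulmx_block.
  rewrite !(mul1mx, mul0mx, mulmx1, mulmx0, addr0, add0r) E1 E2.
  by rewrite det_ublock det_scalar.
have AE i j : (A + ursubmx M *m H) i j =
    (if i == j then u - 1
     else if (i == 0%N :> nat) && (j == 1%N :> nat) then - X
     else if (i == 1%N :> nat) && (j == 0%N :> nat) then - Y
     else - 1) - n%:R * (j == 2 :> nat)%:R.
  rewrite mxE HE; congr (_ + _); first by rewrite !mxE -!val_eqE.
  rewrite -mulNr; congr (_ * _).
  transitivity (\sum_(k < n) (- 1 : R)); last first.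
    by rewrite sumr_const card_ord mulNrn.
  apply: eq_bigr => k _; rewrite !mxE -!val_eqE /=.
  by case: i => -[|[|[|//]]].
rewrite det_mx33 !AE -!val_eqE /=.
have uE : u = n%:R + 3 by rewrite /u -addn3 natrD.
rewrite natrM natrX -/u -[n.+1]addn1 natrD uE.
transitivity ((n%:R + 3) ^+ n * ((n%:R + 1) * (2 - X - Y) + 2 * (1 - X * Y))).
  ring.
by rewrite XY1 subrr mulr0 addr0 mulrA.
Qed.

Definition star_mx n X Y : 'M[R]_n :=
  \matrix_(i < n, j < n)
    if i == j then n%:R - 1
    else if (i == 0%N :> nat) && (1 <= j < n.-1)%N then - X
    else if (j == 0%N :> nat) && (1 <= i < n.-1)%N then - Y
    else - 1.

(* Scaling the first row by [X] and the first column by [Y], and swapping the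
   second and the last vertex, turns one matrix into the other. *)
Lemma det_star_mx n X Y : X * Y = 1 ->
  \det (star_mx n.+3 X Y) = \det (one_edge_mx n.+3 Y X).
Proof.
move=> XY1; pose s := tperm (inord 1 : 'I_n.+3) ord_max.
pose d Z : 'rV[R]_n.+3 := \row_j (if j == 0%N :> nat then Z else 1).
have detd Z : \det (diag_mx (d Z)) = Z.
  rewrite det_diag big_ord_recl !mxE /= big1 ?mulr1 // => i _.
  by rewrite !mxE.
have s0 i : (s i == 0%N :> nat) = (i == 0%N :> nat).
  have s00 : s ord0 = ord0 by rewrite tpermD // -val_eqE /= ?inordK.
  by rewrite -[0%N]/(nat_of_ord (@ord0 n.+2)) !val_eqE -{1}s00 (inj_eq perm_inj).
have s1 i : (s i == 1%N :> nat) = (i == n.+2 :> nat).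
  have -> : 1%N = s ord_max :> nat by rewrite tpermR inordK.
  by rewrite val_eqE (inj_eq perm_inj).
have -> : star_mx n.+3 X Y = diag_mx (d X) *m
    (row_perm s (col_perm s (one_edge_mx n.+3 Y X)) *m diag_mx (d Y)).
  apply/matrixP => i j; rewrite mul_diag_mx mul_mx_diag !mxE.
  rewrite (inj_eq perm_inj) !s0 !s1; case: eqVneq => [<-|neq_ij].
    by case: ifP => _; rewrite ?mulr1 ?mul1r // mulrC -mulrA (mulrC Y) XY1 mulr1.
  move: neq_ij (ltn_ord i) (ltn_ord j); rewrite -val_eqE /=.
  case: (posnP i) => [->|i0]; case: (posnP j) => [->|j0] //=.
  - rewrite !mulr1 => _ _; rewrite ltnS leq_eqVlt => /orP[/eqP->|lt_j].
      by rewrite eqxx ltnn mulrN XY1.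
    by rewrite lt_j (ltn_eqF lt_j) mulrN1.
  - rewrite !mul1r => _; rewrite ltnS leq_eqVlt => /orP[/eqP->|lt_i] _.
      by rewrite eqxx ltnn mulNr XY1.
    by rewrite lt_i (ltn_eqF lt_i) mulN1r.
  - by rewrite !andbF mulr1 mul1r.
rewrite !det_mulmx !detd row_permE col_permE !det_mulmx !det_perm odd_permV.
(* The swap acts on both rows and columns, so its sign occurs squared. *)
have : (-1) ^+ s * (-1) ^+ s = 1 :> R by rewrite -signr_addb addbb.
move: ((-1) ^+ s) (\det _) => e D ee.
transitivity (X * Y * (e * e) * D); first by ring.
by rewrite XY1 ee !mul1r.
Qed.

End OneEdge.

(** * Densities of sets of integers via counting with bounded error *)

Section Density.
Variable R : realType.
Implicit Types (P Q : pred nat) (c : R).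

Definition count_upto P N := (\sum_(i < N) P i)%N.

Lemma count_uptoS P N : count_upto P N.+1 = (count_upto P N + P N)%N.
Proof. exact: big_ord_recr. Qed.

(** A bounded error is stronger than density [c], and is stable under differences of nested sets and
    under finite changes. *)
Definition linear_count P c :=
  exists K : R, forall N, `|(count_upto P N)%:R - c * N%:R| <= K.

Lemma linear_countT : linear_count xpredT 1.
Proof.
exists 0 => N; rewrite /count_upto sum_nat_const card_ord muln1.
by rewrite mul1r subrr normr0.
Qed.

Lemma linear_count0 : linear_count xpred0 0.
Proof. by exists 0 => N; rewrite /count_upto big1 // mul0r subrr normr0. Qed.

Lemma linear_countD P Q c c' : subpred Q P ->
  linear_count P c -> linear_count Q c' -> linear_count (predD P Q) (c - c').
Proof.
move=> QP [K PK] [K' QK']; exists (K + K') => N.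
have -> : (count_upto (predD P Q) N)%:R =
    (count_upto P N)%:R - (count_upto Q N)%:R :> R.
  apply/eqP; rewrite eq_sym subr_eq -natrD -big_split; apply/eqP.
  congr (_%:R); apply: eq_bigr => i _ /=.
  by have := QP i; case: (Q i) (P i) => [|] [] // ->.
have := ler_normB ((count_upto P N)%:R - c * N%:R) ((count_upto Q N)%:R - c' * N%:R).
move/(le_trans); move/(_ _ (lerD (PK N) (QK' N))); congr (`|_| <= _); ring.
Qed.

Lemma linear_count_residue m r : (r < m)%N ->
  linear_count (fun i => i == r %[mod m])%N m%:R^-1.
Proof.
move=> lt_rm; have m0 : (0 < m)%N by apply: leq_trans lt_rm.
have mR0 : 0 < m%:R :> R by rewrite ltr0n.
exists 1 => N; set q := count_upto _ N.
(* The shift makes the quotient jump exactly when passing some $N\equiv r$ modulo $m$. *)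
have qE : q = ((N + (m - r.+1)) %/ m)%N.
  rewrite /q; elim: N {q} => [|N IHN].
    rewrite /count_upto big_ord0 add0n divn_small //; lia.
  rewrite count_uptoS IHN addnC addSn divnS //; congr (nat_of_bool _ + _)%N.
  rewrite -(eqn_modDr (m - r)) subnKC 1?ltnW // modnn -addnS.
  by congr (_ %| N + _)%N; lia.
have := divn_eq (N + (m - r.+1)) m; rewrite -qE => E.
have lt_m := ltn_pmod (N + (m - r.+1)) m0.
have h1 : (q * m <= N + m)%N by lia.
have h2 : (N <= q * m + m)%N by lia.
rewrite -(ler_pM2r mR0) -[X in _ * X](gtr0_norm mR0) -normrM mulrBl mul1r.
rewrite mulrAC mulVf ?gt_eqF // mul1r -natrM ler_norml.
move: h1 h2; rewrite -!(ler_nat R) !natrD; lra.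
Qed.

Lemma linear_count_eventually P Q c n0 :
  (forall n, (n0 <= n)%N -> P n = Q n) -> linear_count P c -> linear_count Q c.
Proof.
move=> PQ [K PK]; exists (n0%:R + K) => N.
have -> : (count_upto Q N)%:R - c * N%:R =
  ((count_upto Q N)%:R - (count_upto P N)%:R) + ((count_upto P N)%:R - c * N%:R).
  by ring.
apply: le_trans (ler_normD _ _) _; apply: lerD (PK N).
have bound P' Q' : (forall n, (n0 <= n)%N -> P' n = Q' n) ->
    (count_upto P' N <= count_upto Q' N + n0)%N.
  (* The sharper bound with [minn N n0] is the one that passes through the induction. *)
  move=> PQ'; apply: (@leq_trans (count_upto Q' N + minn N n0)); last by lia.
  elim: N => [|N IHN]; first by rewrite /count_upto !big_ord0.
  rewrite !count_uptoS; case: (leqP n0 N) => [/PQ' ->|]; first by lia.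
  by case: (P' N) (Q' N) => [|] []; lia.
have := bound _ _ PQ; have /bound : forall n, (n0 <= n)%N -> Q n = P n.
  by move=> n /PQ.
rewrite -!(ler_nat R) !natrD ler_norml; lra.
Qed.

Lemma linear_count_cvg P c : linear_count P c ->
  (#|` fset_set [set u : nat | P u /\ u%:R <= x]|%:R /
     #|` fset_set (A_set x)|%:R : R) @[x --> (+oo : set_system R)] --> c.
Proof.
(* The successor appears because both 0 and the integer part of [x] are counted. *)
have cardE Q (x : R) : 0 <= x ->
    #|` fset_set [set u : nat | Q u /\ u%:R <= x]| = count_upto Q (Num.truncn x).+1.
  move=> x0; set n := Num.truncn x.
  pose s := [seq u <- iota 0 n.+1 | Q u].
  have -> : [set u : nat | Q u /\ u%:R <= x] = [set` [fset u in s]%fset].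
    apply/seteqP; split=> u; rewrite /mkset in_fset mem_filter mem_iota ltnS.
      by case=> -> ux; rewrite truncn_ge_nat.
    by case/andP=> Qu; rewrite truncn_ge_nat.
  rewrite set_fsetK card_fseq undup_id ?filter_uniq ?iota_uniq // size_filter.
  rewrite -sum1_count big_mkcond /count_upto.
  rewrite -(big_mkord xpredT (fun i => Q i : nat)).
  by rewrite /index_iota subn0; apply: eq_bigr => i _; case: (Q i).
move=> [K PK]; apply/cvgrPdist_le => /= e e0; near=> x.
have x0 : 0 < x by near: x; exact/nbhs_pinfty_gt/num_real.
(* The quotient differs from [c] by at most $K/N$ with $N>x$, hence by at most [e]. *)
have Kx : K / e <= x by near: x; exact/nbhs_pinfty_ge/num_real.
have -> : A_set x = [set u : nat | xpredT u /\ u%:R <= x].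
  by apply/seteqP; split=> u //= [].
rewrite !cardE ?(ltW x0) // {2}/count_upto sum_nat_const card_ord muln1.
set N := (Num.truncn x).+1; have N0 : 0 < N%:R :> R by rewrite ltr0n.
have xN : x <= N%:R by rewrite ltW // truncnS_gt.
rewrite -(ler_pM2r N0) -[X in _ * X]gtr0_norm // -normrM mulrBl mulfVK ?gt_eqF //.
rewrite distrC; apply: le_trans (PK N) _.
by rewrite mulrC -ler_pdivrMr // (le_trans Kx).
Unshelve. all: by end_near.
Qed.

End Density.

(** * The characteristic series of the two assignments and its invariants *)

Section CharacteristicSeries.
Variables (l : nat) (l_prime : prime l).
Implicit Types (a : padic l) (n : nat).

Lemma char_matrix_alpha a n : char_matrix (alpha a (u := n)) =
  one_edge_mx n (onePT_pow a) (onePT_pow (- a)).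
Proof.
apply/matrixP => i j; rewrite !mxE /alpha; case: eqVneq => // neq_ij.
case: ltnP => [lt_ij|le_ji].
  have -> : (j == 0%N :> nat) = false by lia.
  by rewrite andbF; case: ifP => // _; rewrite onePT_pow0.
have lt_ji : (j < i)%N by rewrite ltn_neqAle eq_sym neq_ij.
have -> : (i == 0%N :> nat) = false by lia.
by rewrite /= andbC; case: ifP => // _; rewrite oppr0 onePT_pow0.
Qed.

Lemma char_matrix_alpha' a n : char_matrix (alpha' a (u := n)) =
  star_mx n (onePT_pow a) (onePT_pow (- a)).
Proof.
apply/matrixP => i j; rewrite !mxE /alpha'; case: eqVneq => // neq_ij.
case: ltnP => [lt_ij|le_ji].
  have -> : (j == 0%N :> nat) = false by lia.
  by case: ifP => // _; rewrite onePT_pow0.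
have lt_ji : (j < i)%N by rewrite ltn_neqAle eq_sym neq_ij.
have -> : (i == 0%N :> nat) = false by lia.
by rewrite /=; case: ifP => // _; rewrite oppr0 onePT_pow0.
Qed.

(** Both assignments give the same series because the one-edge determinant is symmetric in [X] and
    [Y]. *)
Lemma char_series_alpha a n (gamma : forall u, voltage l u) :
    gamma = alpha a \/ gamma = alpha' a ->
  char_series (gamma n.+3) =
    (n.+3 ^ n * n.+1)%:R * (2 - onePT_pow a - onePT_pow (- a)).
Proof.
have XY : onePT_pow a * onePT_pow (- a) = 1.
  by rewrite onePT_powD // subrr onePT_pow0.
case=> ->; rewrite /char_series ?char_matrix_alpha ?char_matrix_alpha'.
  by rewrite det_one_edge_mx.
by rewrite det_star_mx // det_one_edge_mx 1?addrAC // mulrC.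
Qed.

(* With [X = (1 + T)^a], [2 - X - 1/X = - (X - 1)^2 / X], and [X - 1] is [T]
   times a series with constant term [a]. *)
Lemma onePT_pow_factor a : a \is a GRing.unit -> exists2 V : fps (padic l),
  V \is a GRing.unit &
  2 - onePT_pow a - onePT_pow (- a) = fps_of_poly 'X^2 * V.
Proof.
move=> a_unit; set X := onePT_pow a; set Y := onePT_pow (- a).
have XY : X * Y = 1 by rewrite onePT_powD // subrr onePT_pow0.
pose A := Fps (fun n => padic_binom a n.+1).
have XE : X = 1 + fps_of_poly 'X * A.
  apply: fpsP => n; rewrite [RHS]/(_ + (fps_of_poly 'X * A) n) fps_mulX.
  case: n => [|n]; last exact/esym/add0r.
  exact: etrans (padic_binom0 l_prime a) (esym (addr0 1)).
have Au : A \is a GRing.unit by rewrite fps_unitP /= padic_binom1.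
have Yu : Y \is a GRing.unit by apply/unitrPr; exists X; rewrite mulrC.
exists (- (A * A * Y)); first by rewrite unitrN !unitrM Au.
rewrite fps_of_polyM.
transitivity (- ((X - 1) * (X - 1) * Y) + 2 * (1 - X * Y) - X * (1 - X * Y)).
  ring.
by rewrite XY subrr !mulr0 addr0 subr0 XE; ring.
Qed.

(** The factor $T^2$ gives $\lambda=2-1$, and $\mu$ is the valuation of the integer factor. *)
Lemma invariants_alpha a n (gamma : forall u, voltage l u) :
    a \is a GRing.unit -> gamma = alpha a \/ gamma = alpha' a ->
  mu_inv (char_series (gamma n.+3)) = (n * logn l n.+3 + logn l n.+1)%N /\
  lambda_inv (char_series (gamma n.+3)) = 1.
Proof.
move=> /onePT_pow_factor[V Vu VE] /char_series_alpha->; rewrite VE mulrA.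
have N0 : (0 < n.+3 ^ n * n.+1)%N by rewrite muln_gt0 expn_gt0.
have [-> ->] := weierstrass_invariants l_prime 2 N0 Vu.
by rewrite lognM ?expn_gt0 // lognX.
Qed.

End CharacteristicSeries.

(** * The density of each value of $\mu$ *)

Section MuDensity.
Variables (R : realType) (l : nat) (l_prime : prime l) (l_odd : odd l).

Lemma eqn2_mod_expl u k : (2 < u)%N ->
  (u == 2 %[mod l ^ k])%N = (k <= logn l (u - 2))%N.
Proof.
by move=> u2; rewrite eqn_mod_dvd ?(ltnW u2) // pfactor_dvdn // subn_gt0.
Qed.

Lemma eqn0_mod u : (0 < u)%N -> (u == 0 %[mod l])%N = (0 < logn l u)%N.
Proof.
move=> u0; rewrite mod0n -[(_ == 0)%N]/(l %| u)%N -[l in LHS]expn1.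
by rewrite pfactor_dvdn.
Qed.

(** A common divisor of $u$ and $u-2$ divides 2, and $\ell$ is odd. *)
Lemma logn_sub2_eq0 u : (2 < u)%N -> (0 < logn l u)%N -> logn l (u - 2) = 0%N.
Proof.
move=> u2 lu; apply/eqP; rewrite -leqn0 leqNgt; apply/negP => lu2.
have : (l %| u)%N by rewrite -[l]expn1 pfactor_dvdn // (leq_trans _ u2).
rewrite -(subnK (ltnW u2)) dvdn_addr; last first.
  by rewrite -[l in (l %| _)%N]expn1 pfactor_dvdn // subn_gt0.
by rewrite dvdn_prime2 // => /eqP l2; move: l_odd; rewrite l2.
Qed.

(** This makes 2 a reduced residue, as [linear_count_residue] requires. *)
Lemma two_lt_odd_prime_exp k : (2 < l ^ k.+1)%N.
Proof.
have l2 : (2 < l)%N by have := prime_gt1 l_prime; have := l_odd; case: (l) => [|[|[]]].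
by rewrite (leq_trans l2) // -[X in (X <= _)%N]expn1 leq_exp2l // ltnW.
Qed.

(** For large $u$ the condition becomes one on residues: neither 0 nor 2 modulo $\ell$ if $\mu=0$,
    otherwise 2 modulo $\ell^\mu$ but not modulo $\ell^{\mu+1}$. *)
Lemma linear_count_mu mu : linear_count
  (fun u => (2 < u) && ((u - 3) * logn l u + logn l (u - 2) == mu))%N
  (if mu == 0%N then (l%:R - 2) / l%:R else (l%:R - 1) / l%:R ^+ mu.+1 : R).
Proof.
have l0 : l%:R != 0 :> R by rewrite pnatr_eq0 -lt0n prime_gt0.
have res k := linear_count_residue R (two_lt_odd_prime_exp k).
case: mu => [|mu] /=.
  have -> : (l%:R - 2) / l%:R = 1 - l%:R^-1 - (l ^ 1)%:R^-1 :> R.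
    by rewrite expn1; field.
  (* From 4 on, $u-3$ is positive, so $\mu=0$ does force $\ell\nmid u$. *)
  apply: (@linear_count_eventually _ _ _ _ 4);
    last apply: linear_countD (res 0%N); last first.
  - apply: linear_countD (linear_countT R) _ => //.
    exact: linear_count_residue (prime_gt0 l_prime).
  - move=> u /= /eqP; rewrite expn1 andbT => ->.
    by rewrite mod0n modn_small // -[l]expn1 two_lt_odd_prime_exp.
  move=> u u4; have u2 : (2 < u)%N by apply: ltnW.
  rewrite /= eqn2_mod_expl // eqn0_mod ?(leq_trans _ u4) //=.
  have /negPf u3 : (u - 3 != 0)%N by lia.
  by rewrite addn_eq0 muln_eq0 u3; lia.
have -> : (l%:R - 1) / l%:R ^+ mu.+2 = (l ^ mu.+1)%:R^-1 - (l ^ mu.+2)%:R^-1 :> R.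
  by rewrite !natrX !exprS; field; rewrite l0 expf_neq0.
(* Past this threshold $u-3$ exceeds the target [mu.+1], which excludes every multiple of $\ell$. *)
apply: (@linear_count_eventually _ _ _ _ (mu + 5));
  last apply: linear_countD (res mu) (res mu.+1).
  move=> u u4; have u2 : (2 < u)%N by lia.
  rewrite /= !eqn2_mod_expl // u2 /=.
  have := logn_sub2_eq0 u2; case: (logn l u) => [_|w /(_ isT) ->].
    by rewrite muln0 add0n; lia.
  by rewrite addn0 mulnS; move: ((u - 3) * w)%N => t; lia.
move=> u /= /eqP u2; apply/eqP.
have /(dvdn_exp2l l) d : (mu.+1 <= mu.+2)%N by [].
by rewrite -(modn_dvdm u d) u2 modn_dvdm.
Qed.

End MuDensity.

Theorem theorem6p4 (R : realType) (l : nat) (l_prime : prime l)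
    (l_odd : odd l) (a : padic l) (a_unit : a \is a GRing.unit)
    (gamma : forall u : nat, voltage l u)
    (gammaE : gamma = alpha a \/ gamma = alpha' a)
    (mu : nat) (lambda : int) :
  (#|` fset_set (T_set mu lambda gamma x)|%:R /
     #|` fset_set (A_set x)|%:R : R) @[x --> (+oo : set_system R)] -->
  (if lambda == 1 then
     if mu == 0%N then (l%:R - 2) / l%:R
     else (l%:R - 1) / l%:R ^+ mu.+1
   else 0 : R).
Proof.
have inv u : (2 < u)%N -> mu_inv (char_series (gamma u)) =
    ((u - 3) * logn l u + logn l (u - 2))%N /\
    lambda_inv (char_series (gamma u)) = 1.
  case: u => [|[|[|n]]] // _; rewrite !subSS !subn0.
  exact: (invariants_alpha l_prime n a_unit gammaE).
(* With the test on [lambda] inside the predicate, the case $\lambda\ne1$ becomes the count of an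
   empty set. *)
pose P u := [&& (2 < u)%N, ((u - 3) * logn l u + logn l (u - 2) == mu)%N
  & lambda == 1].
have TE x : T_set mu lambda gamma x = [set u | P u /\ u%:R <= x].
  apply/seteqP; split=> u; rewrite /T_set /P /=.
    by case=> u3 ux <- <-; have [-> ->] := inv u u3; rewrite u3 !eqxx.
  by case=> /and3P[u3 /eqP <- /eqP ->] ux; have [-> ->] := inv u u3.
under eq_fun do rewrite TE.
apply: linear_count_cvg; rewrite /P; case: eqVneq => _.
  apply: (linear_count_eventually (n0 := 0%N)) (linear_count_mu R l_prime _ mu) => //.
  by move=> n _; rewrite andbT.
apply: (linear_count_eventually (n0 := 0%N)) (linear_count0 R) => n _.
by rewrite !andbF.
Qed.
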